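(* Let $k\ge 2$ be an integer. Then the set $\mathcal{T}_k=\{\mathrm{SW}_k(T): T \text{ is a finite tree}\}$ is cofinite (that is, it contains all sufficiently large positive integers) if and only if $k$ is even.
   Context: For a connected graph $G$ and a set $S\subset V(G)$, the Steiner distance $d_G(S)$ is the minimum number of edges in a connected subgraph of $G$ containing every vertex of $S$. For $k\ge 2$, the Steiner--Wiener $k$ index of $G$ is $\mathrm{SW}_k(G)=\sum_{S\subset V(G),\,|S|=k} d_G(S)$. *)

(* Defs.v *)
From HB Require Import structures.
From mathcomp Require Import all_boot.

Set Implicit Arguments.
Unset Strict Implicit.
Unset Printing Implicit Defensive.

Record sgraph := SGraph {
  vertex :> finType;
  adj : rel vertex;
  adj_sym : symmetric adj;
  adj_irrefl : irreflexive adj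
}.

Definition edges (G : sgraph) : {set {set G}} :=
  [set E : {set G} | [exists x, exists y, adj x y && (E == [set x; y])]].

Definition connected (G : sgraph) : Prop :=
  0 < #|G| /\ forall x y : G, connect (@adj G) x y.

Definition acyclic (G : sgraph) : Prop :=
  forall p : seq G, 2 < size p -> ~ ucycle (@adj G) p.

Definition is_tree (G : sgraph) : Prop := connected G /\ acyclic G.

(* The pair H = (W, F) stands for the subgraph with vertex set W and edge set
   F; W may contain more vertices than those covered by F. *)
Definition is_subgraph (G : sgraph) (H : {set G} * {set {set G}}) : bool :=
  (H.2 \subset edges G) && [forall E in H.2, E \subset H.1].

Definition subgraph_connected (G : sgraph) (H : {set G} * {set {set G}}) :
    bool :=
  (H.1 != set0) &&
  [forall x in H.1, forall y in H.1,
     connect [rel u v : G | [set u; v] \in H.2] x y].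

(* When G is connected, the whole graph is itself an admissible subgraph, so
   this is a true minimum; the value is meaningless otherwise. *)
Definition steiner_dist (G : sgraph) (S : {set G}) : nat :=
  #|[arg min_(H < ([set: G], edges G)
       | [&& is_subgraph H, subgraph_connected H & S \subset H.1]) #|H.2|].2|.

Definition SW (k : nat) (G : sgraph) : nat :=
  \sum_(S : {set G} | #|S| == k) steiner_dist S.

Definition SW_tree_values (k n : nat) : Prop :=
  exists T : sgraph, is_tree T /\ SW k T = n.

Definition cofinite (A : nat -> Prop) : Prop :=
  exists N, forall n, N <= n -> A n.

(* Main.v *)
Require Import Defs.
From mathcomp Require Import all_boot.
From mathcomp Require Import all_order all_algebra zify ring.

(** Removing an edge e from a tree T on n vertices leaves two components, of
    sizes a and n - a. The minimal subtree containing S consists of the edges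
    that separate two vertices of S, so counting pairs (S, e) by e gives

      SW_k(T) = sum over e of f_n(a_e),
      f_n(a) = C(n,k) - C(a,k) - C(n-a,k)

    ([steiner_dist_cut], [SW_cut]).

    Odd k. Modulo n - k + 1, C(n-a,k) k! is congruent to (-1)^k C(a,k) k!, hence
    n - k + 1 divides k! SW_k(T) ([dvdn_SW]). If SW_k(T) is a prime p, then
    n - k + 1 either divides k!, which bounds n and SW_k(T), or is a multiple
    of p, and then SW_k(T) >= C(n,k) > p. So no large prime is a value.

    Even k. Only trees of depth two with n = N + 1 vertices, N odd, are used: a
    root, and below it branches that are stars with b leaves, for b in a list Q.
    The list is constrained by its weight, the sum of the b + 1, being at most N
    (single vertices fill up the rest), and the index is N C(N,k-1) plus the sum
    over Q of

      g(b) = C(N,k) - C(b+1,k) - C(N-b,k)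

    ([depth2_value]). Replacing some branches of Q by others changes the index
    by an integral combination of values of g. The differences
    w_j = +- (Delta^j g)(0) are of order N^(k-j), and because k is even w_k = 2
    while w_(k-1) = N - k is odd; so the w_j generate all integers. What has to
    be controlled is the weight: a number below w_(j-1) is a multiple of w_j, up
    to a factor of order N, plus a remainder below w_j, and N copies of Delta^j
    weigh more than N. Differences with a large constant step d solve this:
    Delta_d^2 Delta^(j-2) g has about d^2 times the value of Delta^j g, for
    about d times the weight. With O(N/d^2) copies of it and O(1) copies of
    Delta^j g for each j, every offset from 0 to g(1) is realised with weight
    at most N/16 ([cheap_cover]). The remaining weight holds further branches with
    b = 1, up to N/4 of them, each of which raises the index by g(1)
    ([interval_values]). The resulting interval of values has length of order
    N^k, so it reaches the one for N + 2 ([intervals_overlap]). *)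

Set Implicit Arguments.
Unset Strict Implicit.
Unset Printing Implicit Defensive.

(** * Cuts in trees *)

Definition splits (V : finType) (A S : {set V}) : bool :=
  ~~ (S \subset A) && ~~ (S \subset ~: A).

Lemma splits2 (V : finType) (A : {set V}) x y :
  splits A [set x; y] = ((x \in A) != (y \in A)).
Proof.
by rewrite /splits !subUset !sub1set !inE; case: (x \in A); case: (y \in A).
Qed.

Lemma splitsP (V : finType) (A S : {set V}) :
  reflect (exists x y, [/\ x \in S, y \in S, x \in A & y \notin A]) (splits A S).
Proof.
apply: (iffP andP) => [[/subsetPn[y yS yA] /subsetPn[x xS]]|].
  by rewrite inE negbK => xA; exists x, y.
move=> [x [y [xS yS xA yA]]]; split; apply/subsetPn; first by exists y.
by exists x; rewrite ?inE ?negbK.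
Qed.

Lemma connect_exit (V : finType) (r : rel V) (B : {set V}) u v :
  connect r u v -> u \in B -> v \notin B ->
  exists a b, [/\ r a b, a \in B & b \notin B].
Proof.
case/connectP=> p; elim: p u => [|w p IHp] u /=; first by move=> _ -> ->.
case/andP=> ruw pth lst uB vB.
have [wB|wB] := boolP (w \in B); last by exists u, w.
exact: IHp pth lst wB vB.
Qed.

Lemma in_edges2 (G : sgraph) (x y : G) : ([set x; y] \in edges G) = adj x y.
Proof.
rewrite inE; apply/existsP/idP => [[u /existsP[v /andP[uv /eqP E]]]|xy]; last first.
  by exists x; apply/existsP; exists y; rewrite xy eqxx.
have xE : x \in [set u; v] by rewrite -E set21.
have yE : y \in [set u; v] by rewrite -E set22.
have uE : u \in [set x; y] by rewrite E set21.
have vE : v \in [set x; y] by rewrite E set22.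
move: xE yE uE vE; rewrite !inE.
have nuv : u != v by apply: contraTneq uv => ->; rewrite adj_irrefl.
case/orP=> /eqP xE; case/orP=> /eqP yE; rewrite xE yE // ?orbb.
- by move=> _ vu; move: nuv; rewrite (eqP vu) eqxx.
- by rewrite adj_sym.
- by move=> /eqP uv'; move: nuv; rewrite uv' eqxx.
Qed.

Lemma edgesP (G : sgraph) (E : {set G}) :
  reflect (exists x y : G, adj x y /\ E = [set x; y]) (E \in edges G).
Proof.
apply: (iffP idP) => [|[x [y [xy ->]]]]; last by rewrite in_edges2.
rewrite inE => /existsP[x /existsP[y /andP[xy /eqP->]]].
by exists x, y.
Qed.

(** Edges are indexed by an arbitrary finite type so that the same theory serves
    an abstract tree, indexed by its edges, and a rooted one, indexed by its
    non-root vertices. Each A i is one of the two components left by removing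
    eps i: the edge eps i is the only one that leaves it. *)
Definition cut_system (G : sgraph) (I : finType) (eps A : I -> {set G}) : Prop :=
  edges G = [set eps i | i : I] /\ forall i j, splits (A i) (eps j) = (i == j).

Section CutSystem.
Variables (G : sgraph) (I : finType) (eps A : I -> {set G}).
Hypothesis cutA : cut_system eps A.

Lemma cut_edge x y : adj x y -> exists i, eps i = [set x; y].
Proof.
rewrite -in_edges2 (proj1 cutA) => /imsetP[i _ ->]; by exists i.
Qed.

Lemma cut_inj : injective eps.
Proof.
by move=> i j eij; apply/eqP; rewrite -(proj2 cutA) -eij (proj2 cutA) eqxx.
Qed.

Lemma cut_adj i x y : adj x y -> (x \in A i) != (y \in A i) -> eps i = [set x; y].
Proof.
by move=> /cut_edge[j ej]; rewrite -splits2 -ej (proj2 cutA) => /eqP->.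
Qed.

Lemma path_same_side i u x p :
  path (@adj G) x p -> u \in eps i -> u \notin x :: p ->
  (last x p \in A i) = (x \in A i).
Proof.
move=> + ui; elim: p x => //= z p IHp x /andP[xz pth].
rewrite inE negb_or => /andP[nux up]; rewrite IHp //.
apply/eqP/negPn/negP; rewrite eq_sym => /(cut_adj xz) ei.
by move: ui up; rewrite ei !inE (negPf nux) /= => /eqP->; rewrite eqxx.
Qed.

(** A simple path uses each of its edges once, so it crosses the cut of that edge
    once and ends on the other side. *)
Lemma uniq_path_splits u p :
  path (@adj G) u p -> uniq (u :: p) ->
  path [rel a b | [exists i, (eps i == [set a; b]) &&
                    ((u \in A i) != (last u p \in A i))]] u p.
Proof.
elim: p u => //= w p IHp u /andP[uw pth] /andP[]; rewrite inE negb_or.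
move=> /andP[nuw up] /andP[wp up'].
have {IHp} := IHp w pth; rewrite /= wp up' => /(_ isT) IHp.
have keep i : eps i != [set u; w] -> (u \in A i) = (w \in A i).
  by apply: contraNeq => /(cut_adj uw)/eqP.
have uwp : u \notin w :: p by rewrite inE negb_or nuw.
apply/andP; split.
  have [i ei] := cut_edge uw; apply/existsP; exists i; rewrite ei eqxx /=.
  rewrite (path_same_side pth _ uwp) ?ei ?set21 //.
  by rewrite -splits2 -ei (proj2 cutA).
have pu : all (mem (predC1 u)) (w :: p).
  by apply/allP => z zp; rewrite !inE; apply: contraNneq uwp => <-.
apply: (sub_in_path _ pu) IHp => a b; rewrite !inE => au bu.
case/existsP=> i /andP[/eqP ei sp]; apply/existsP; exists i.
rewrite ei eqxx /= keep // ei; apply/eqP => /setP/(_ u).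
by rewrite !inE eqxx /= ![u == _]eq_sym (negPf au) (negPf bu).
Qed.

Lemma connect_cut u v : connect (@adj G) u v ->
  connect [rel a b | [exists i, (eps i == [set a; b]) &&
                    ((u \in A i) != (v \in A i))]] u v.
Proof.
case/connectP=> p /shortenP[p' pth' up' _] ->.
by apply/connectP; exists p' => //; apply: uniq_path_splits.
Qed.

(** A connected subgraph containing S must use every edge whose cut splits S;
    conversely these edges suffice, since two vertices of S are joined by a path
    all of whose edges separate them. *)
Lemma steiner_dist_cut (S : {set G}) : connected G -> S != set0 ->
  steiner_dist S = #|[set i | splits (A i) S]|.
Proof.
move=> [_ conG] /set0Pn[s sS]; rewrite /steiner_dist.
set P := fun H => _.
have lower H : P H -> #|[set i | splits (A i) S]| <= #|H.2|.
  case/and3P=> /andP[subH _] /andP[_ /forall_inP conH] SH.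
  rewrite -(card_imset _ cut_inj); apply/subset_leq_card/subsetP => E /imsetP[i + ->].
  rewrite inE => /splitsP[x [y [xS yS xA yA]]].
  have /forall_inP/(_ y (subsetP SH _ yS)) := conH x (subsetP SH _ xS).
  case/connect_exit/(_ xA yA)=> a [b [/= abH aA bA]].
  by rewrite (@cut_adj i a b) ?aA ?(negPf bA) // -in_edges2 (subsetP subH).
have upper : exists2 H, P H & #|H.2| <= #|[set i | splits (A i) S]|.
  pose F := [set eps i | i in [set i | splits (A i) S]].
  pose r := [rel u v : G | [set u; v] \in F].
  pose C := [set x | connect r s x].
  (* Keeping only the edges inside C makes the pair a connected subgraph; by the
     lower bound no edge is lost. *)
  exists (C, [set E in F | E \subset C]); last first.
    rewrite -(card_imset _ cut_inj); apply: subset_leq_card.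
    by apply/subsetP => E; rewrite inE => /andP[].
  apply/and3P; split.
  - apply/andP; split => /=.
      apply/subsetP => E; rewrite inE => /andP[/imsetP[i _ ->] _].
      by rewrite (proj1 cutA) imset_f.
    by apply/forall_inP => E; rewrite inE => /andP[].
  - apply/andP; split; first by apply/set0Pn; exists s; rewrite inE.
    set r' := [rel u v | _].
    have r'_sym : connect_sym r'.
      by apply: sym_connect_sym => a b /=; rewrite setUC.
    have sC x : x \in C -> connect r' s x.
      rewrite inE => /connectP[p]; elim/last_ind: p x => [|p y IHp] x /=.
        by move=> _ ->.
      rewrite rcons_path last_rcons => /andP[pth ry] ->.
      have cl : connect r s (last s p) by apply/connectP; exists p.
      apply: connect_trans (IHp _ pth erefl) (connect1 _).
      rewrite /r' /= inE [_ \in F]ry subUset !sub1set !inE cl /=.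
      exact: connect_trans cl (connect1 ry).
    apply/forall_inP => x xC; apply/forall_inP => y yC.
    by apply: connect_trans (sC y yC); rewrite r'_sym sC.
  - apply/subsetP => v vS; rewrite inE.
    apply: connect_sub (connect_cut (conG s v)) => a b /existsP[i].
    case/andP=> /eqP ei sp; apply: connect1; rewrite /= -ei; apply: imset_f.
    rewrite inE; apply/splitsP; move: sp.
    case: (boolP (s \in A i)); case: (boolP (v \in A i)) => // vA sA _.
      by exists s, v.
    by exists v, s.
case: arg_minnP => [|H PH minH].
  apply/and3P; split; last exact: subsetT.
  - apply/andP; split => //=; apply/forall_inP => E _; exact: subsetT.
  - apply/andP; split; first by apply/set0Pn; exists s.
    apply/forall_inP => x _; apply/forall_inP => y _.
    by rewrite (eq_connect (e' := @adj G)) // => a b /=; rewrite in_edges2.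
apply/eqP; rewrite eqn_leq lower // andbT.
by case: upper => H' PH'; apply: leq_trans (minH _ PH').
Qed.

End CutSystem.

Definition cutval (n k a : nat) : nat := 'C(n, k) - 'C(a, k) - 'C(n - a, k).

Lemma card_splits (V : finType) (A : {set V}) k : 0 < k ->
  #|[set S : {set V} | (#|S| == k) && splits A S]| = cutval #|V| k #|A|.
Proof.
move=> k0; rewrite /cutval -(_ : #|~: A| = #|V| - #|A|) -?card_draws; last first.
  by rewrite cardsCs setCK.
rewrite -(cards_draws A) -(cards_draws (~: A)).

set X := [set S : {set V} | (#|S| == k) && splits A S].
set Y := [set S : {set V} | (S \subset A) && (#|S| == k)].
set Z := [set S : {set V} | (S \subset ~: A) && (#|S| == k)].
have dYZ : Y :&: Z = set0.
  apply/setP => S; rewrite !inE; apply/negbTE/negP.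
  case/andP=> /andP[SA /eqP cS] /andP[]; rewrite subsetC => AS _.
  have : S \subset ~: S by apply: subset_trans SA AS.
  move: k0; rewrite -cS card_gt0 => /set0Pn[x xS] /subsetP/(_ x xS).
  by rewrite inE xS.
have -> : [set S : {set V} | #|S| == k] = X :|: (Y :|: Z).
  by apply/setP => S; rewrite !inE /splits; case: eqP; case: (_ \subset A); case: (_ \subset ~: A).
have dX : X :&: (Y :|: Z) = set0.
  by apply/setP => S; rewrite !inE /splits; case: eqP; case: (_ \subset A); case: (_ \subset ~: A).
rewrite !cardsU dX dYZ !cards0 !subn0; lia.
Qed.

Lemma SW_cut (G : sgraph) (I : finType) (eps A : I -> {set G}) k :
  connected G -> cut_system eps A -> 0 < k ->
  SW k G = \sum_(i : I) cutval #|G| k #|A i|.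
Proof.
move=> conG cutA k0; rewrite /SW.
rewrite (eq_bigr (fun S => \sum_(i : I) splits (A i) S)) => [|S /eqP cS].
  rewrite exchange_big /=; apply: eq_bigr => i _.
  rewrite -card_splits // -sum1_card.
  rewrite [RHS](eq_bigl (fun S : {set G} => (#|S| == k) && splits (A i) S)).
    by rewrite [RHS]big_mkcondr; apply: eq_bigr => S _; case: splits.
  by move=> S; rewrite inE.
rewrite (steiner_dist_cut cutA) // -?card_gt0 ?cS //.
rewrite -sum1_card big_mkcond; apply: eq_bigr => i _.
by rewrite inE; case: splits.
Qed.

(** Removing one edge {x, y} from a cycle of length at least 3 leaves a simple
    path from y to x; the cut of its first edge separates x from y and is thus
    also crossed by {x, y}, which is impossible. *)
Lemma is_tree_cut (G : sgraph) (I : finType) (eps A : I -> {set G}) :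
  connected G -> cut_system eps A -> is_tree G.
Proof.
move=> conG cutA; split=> // -[|x [|y [|z p]]] // _.
rewrite /ucycle => /andP[/= /and3P[xy yz]]; rewrite rcons_path.
case/andP=> pth zx /andP[+ +]; rewrite !inE !negb_or.
move=> /and3P[nxy nxz xp] /and3P[/andP[nyz yp] zp up].
have := @uniq_path_splits _ _ _ _ cutA y (z :: rcons p x).
rewrite /= rcons_path last_rcons yz pth zx mem_rcons rcons_uniq !inE.
rewrite mem_rcons !inE !negb_or yp zp up xp nyz eq_sym nxy eq_sym nxz.
case/(_ isT isT)/andP=> /existsP[i /andP[/eqP ei sp]] _.
have := cut_adj cutA xy; move=> /(_ i); rewrite eq_sym sp => /(_ isT).
move=> e; have := set21 x y; rewrite -e ei !inE (negPf nxy).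
by rewrite (negPf nxz).
Qed.

(** The cut of an edge is the set of vertices reachable from one of its ends
    without using it; it misses the other end because there is no cycle. *)
Lemma tree_cut (G : sgraph) : is_tree G ->
  exists A : {E : {set G} | E \in edges G} -> {set G}, cut_system val A.
Proof.
move=> [_ acG].
pose P (i : {E : {set G} | E \in edges G}) (B : {set G}) :=
  forall j : {E : {set G} | E \in edges G}, splits B (val j) = (i == j).
suff /fin_all_exists[A HA] : forall i, exists B, P i B.
  exists A; split; last exact: HA.
  apply/setP => E; apply/idP/imsetP => [EG|[j _ ->]]; last exact: valP.
  by exists (Sub E EG).
move=> i; have /edgesP[x [y [xy ei]]] := valP i.
pose r := [rel u v : G | adj u v && ([set u; v] != val i)].
exists [set z | connect r x z] => j.
have /edgesP[u [v [uv ej]]] := valP j.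
rewrite ej splits2; have [ij|nij] := eqVneq i j; last first.
  rewrite !inE.
  have ruv : r u v by rewrite /r /= uv -ej (inj_eq val_inj) eq_sym.
  apply/negbTE; rewrite negbK; apply/eqP; apply/idP/idP => c.
    by apply: connect_trans c _; apply: connect1.
  apply: connect_trans c _; apply: connect1.
  by move: ruv; rewrite /r /= setUC adj_sym.
rewrite -splits2 -ej -ij ei splits2 !inE connect0.
apply/eqP => /esym /connectP[p /shortenP[p' pth up _]] lp.
case: p' pth up lp => [|z [|w q]] /=.
- by move=> _ _ yx; move: xy; rewrite yx adj_irrefl.
- by rewrite ei => + _ e; rewrite -e eqxx andbF.
set p' := [:: z, w & q] => pth up lp.
apply: (acG (x :: p')) => //; apply/andP; split; last exact: up.
have lp' : last x p' = y by rewrite lp.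
rewrite /cycle rcons_path lp' adj_sym xy andbT.
have pth' : path r x p' by exact: pth.
by apply: (sub_path _ pth') => a b /= /andP[].
Qed.

(** * Odd k: divisibility of the index *)

Section Divisibility.
Import GRing.Theory.
Local Open Scope ring_scope.

Lemma ffactZ (a k : nat) : (a ^_ k)%:Z = \prod_(i < k) (a%:Z - i%:Z).
Proof.
elim: k => [|k IHk]; first by rewrite ffactn0 big_ord0.
rewrite ffactnSr PoszM IHk big_ord_recr /=.
have [ka|ak] := leqP k a; first by rewrite subzn.
by rewrite -IHk ffact_small // !mul0r.
Qed.

Lemma prod_subl_mod (m : int) k (F : nat -> int) :
  exists q, \prod_(i < k) (m - F i) = (-1) ^+ k * \prod_(i < k) F i + m * q.
Proof.
elim: k => [|k [q IHk]]; first by exists 0; rewrite !big_ord0; ring.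
rewrite !big_ord_recr /= IHk exprS.
exists ((-1) ^+ k * \prod_(i < k) F i + q * (m - F k)); ring.
Qed.

Lemma dvdn_ffact_add (n k a : nat) : odd k -> (k <= n)%N -> (a <= n)%N ->
  (n.+1 - k %| a ^_ k + (n - a) ^_ k)%N.
Proof.
move=> ok kn an; set m := (n.+1 - k)%N.
have [q] := prod_subl_mod m k (fun i => a%:Z - i%:Z).
rewrite -signr_odd ok expr1 -ffactZ => E.
have Eb : ((n - a) ^_ k)%:Z = \prod_(i < k) (m%:Z - (a%:Z - i%:Z)).
  rewrite ffactZ (reindex_inj rev_ord_inj) /=; apply: eq_bigr => i _.
  have := ltn_ord i; rewrite /m; lia.
have : (m %| (a ^_ k + (n - a) ^_ k)%:Z)%Z.
  by rewrite PoszD Eb E; apply/dvdzP; exists q; ring.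
by [].
Qed.

End Divisibility.

Lemma bin_addl a b k : 0 < k -> 'C(a, k) + 'C(b, k) <= 'C(a + b, k).
Proof.
case: k => // k _; elim: a => // a IHa.
by rewrite addSn !binS; have := leq_bin2l k (leq_addr b a); lia.
Qed.

Lemma cutval_add n k a : 0 < k -> a <= n ->
  cutval n k a + 'C(a, k) + 'C(n - a, k) = 'C(n, k).
Proof.
move=> k0 an; suff: 'C(a, k) + 'C(n - a, k) <= 'C(n, k).
  by rewrite /cutval; lia.
have := bin_addl a (n - a) k0; rewrite subnKC //.
Qed.

(** Modulo m = n - k + 1 the falling factorial of n - a is the product of the
    k factors i - a, i < k, so for odd k it cancels that of a. *)
Lemma dvdn_cutval n k a : odd k -> k <= n -> a <= n ->
  n.+1 - k %| k`! * cutval n k a.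
Proof.
move=> ok kn an.
have k0 : 0 < k by case: k ok {kn}.
have := cutval_add k0 an => /(congr1 (muln k`!)).
rewrite !mulnDr ![_ * 'C(_, _)]mulnC !bin_ffact -addnA => E.
rewrite -(dvdn_addl _ (dvdn_ffact_add ok kn an)) E.
by case: k k0 kn {E ok} => // k _ kn; rewrite ffactnSr subSS dvdn_mull.
Qed.

Lemma SW_lower (G : sgraph) k : is_tree G -> 1 < k -> 'C(#|G|, k) <= SW k G.
Proof.
move=> tG k1; have [A cutA] := tree_cut tG; case: tG => conG _.
rewrite /SW -card_draws -sum1_card big_mkcond [X in _ <= X]big_mkcond /=.
apply: leq_sum => S _; rewrite inE; case: eqP => // cS.
rewrite (steiner_dist_cut cutA) // -?card_gt0; last by rewrite cS; lia.
have : 1 < #|S| by rewrite cS.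
case/card_gt1P=> u [v [uS vS uv]].
have := connect_cut cutA (proj2 conG u v).
have u1 : u \in [set u] by rewrite inE.
have v1 : v \notin [set u] by rewrite inE eq_sym.
case/connect_exit/(_ u1 v1)=> a [b [/existsP[i /andP[_ sp]] _ _]].
apply/card_gt0P; exists i; rewrite inE; apply/splitsP; move: sp.
case: (boolP (u \in A i)); case: (boolP (v \in A i)) => // vA uA _.
  by exists u, v.
by exists v, u.
Qed.

Lemma SW_upper (G : sgraph) k : is_tree G -> 0 < k -> SW k G <= 4 ^ #|G|.
Proof.
move=> tG k0; have [A cutA] := tree_cut tG; case: tG => conG _.
rewrite (SW_cut conG cutA k0).
apply: (@leq_trans (\sum_(i : {E | E \in edges G}) 2 ^ #|G|)).
  apply: leq_sum => i _; apply: leq_trans (leq_trans (leq_subr _ _) (leq_subr _ _)) _.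
  rewrite -card_draws -[#|G|]cardsT -card_powerset.
  by apply/subset_leq_card/subsetP => S _; rewrite inE subsetT.
rewrite sum_nat_const (_ : 4 = 2 * 2) // expnMn leq_mul2r; apply/orP; right.
rewrite card_sig -[#|G|]cardsT -card_powerset.
by apply/subset_leq_card/subsetP => S _; rewrite inE subsetT.
Qed.

Lemma dvdn_SW (G : sgraph) k : is_tree G -> odd k -> k <= #|G| ->
  #|G|.+1 - k %| k`! * SW k G.
Proof.
move=> tG ok kG; have [A cutA] := tree_cut tG; case: tG => conG _.
have k0 : 0 < k by case: k ok {kG}.
rewrite (SW_cut conG cutA k0) big_distrr /=; apply: dvdn_sum => i _.
by apply: dvdn_cutval => //; apply: max_card.
Qed.

Lemma leq_bin n k : 0 < k -> k < n -> n <= 'C(n, k).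
Proof.
elim: n k => // n IHn [//|k] _; rewrite ltnS leq_eqVlt => /orP[/eqP <-|kn].
  by rewrite binSn.
have b0 : 0 < 'C(n, k) by rewrite bin_gt0 ltnW // ltnW.
by rewrite binS; have := IHn k.+1 isT kn; lia.
Qed.

(** A large prime p is not a value: the divisor n - k + 1 of k! p either divides
    k!, and then the tree is too small, or is at least p, and then the tree is
    too large. *)
Lemma odd_not_cofinite k : 1 < k -> odd k -> ~ cofinite (SW_tree_values k).
Proof.
move=> k1 ok [N HN]; set M := k`! + k.
have [p pN pp] := prime_above (N + 4 ^ M).
have [T [tT SWp]] : SW_tree_values k p by apply: HN; lia.
have low := SW_lower tT k1; have up := SW_upper tT (ltnW k1).
rewrite SWp in low up.
have Mn : M < #|T|.
  rewrite ltnNge; apply/negP => nM.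
  have := leq_pexp2l (isT : 0 < 4) nM; lia.
have kn : k < #|T| by rewrite /M in Mn; lia.
have := dvdn_SW tT ok (ltnW kn); rewrite SWp.
have [pn|pn] := boolP (p %| #|T|.+1 - k).
  have := dvdn_leq _ pn; rewrite subn_gt0 ltnS (ltnW kn) => /(_ isT) pn' _.
  have := leq_bin (ltnW k1) kn; lia.
rewrite Gauss_dvdl; last by rewrite coprime_sym prime_coprime.
move/(dvdn_leq (fact_gt0 k)); rewrite /M in Mn; lia.
Qed.

(** * Trees of depth two *)

Section DepthTwo.
Variables (W : finType) (par : W -> option W).
Hypothesis depth2 : forall w w', par w = Some w' -> par w' = None.

Let child (x y : option W) := if x is Some w then par w == y else false.

Lemma par_neq w : par w != Some w.
Proof. by apply/eqP => e; have := depth2 e; rewrite e. Qed.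

Fact depth2_sym : symmetric (fun x y => child x y || child y x).
Proof. by move=> x y; rewrite orbC. Qed.

Fact depth2_irrefl : irreflexive (fun x y => child x y || child y x).
Proof. by case=> [w|] //=; rewrite orbb (negPf (par_neq w)). Qed.

Definition depth2_graph := SGraph depth2_sym depth2_irrefl.

Let eps (w : W) : {set depth2_graph} := [set Some w; par w].
Let A (w : W) : {set depth2_graph} := [set x | (x == Some w) || child x (Some w)].

Lemma depth2_connected : connected depth2_graph.
Proof.
split; first by apply/card_gt0P; exists None.
have cp (w : W) : connect (@adj depth2_graph) (Some w) (par w).
  by apply: connect1; rewrite /= eqxx.
have c0 (x : depth2_graph) : connect (@adj depth2_graph) x None.
  case: x => [w|]; last exact: connect0.
  apply: connect_trans (cp w) _.
  case e : (par w) => [w'|]; last exact: connect0.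
  by rewrite -(depth2 e).
move=> x y; apply: connect_trans (c0 x) _.
by rewrite (sym_connect_sym (@adj_sym depth2_graph)).
Qed.

Lemma depth2_cut : cut_system eps A.
Proof.
split.
  apply/setP => E; apply/edgesP/imsetP => [[x [y [xy ->]]]|[w _ ->]].
    case/orP: xy; [case: x => // w|case: y => // w] => /eqP <-; exists w => //.
    by rewrite setUC.
  by exists (Some w), (par w); rewrite /= eqxx.
move=> i j; rewrite splits2 !inE [Some j == _]eq_sym /=.
have -> : (Some i == Some j) = (i == j) by [].
have -> : child (par j) (Some i) = false.
  by case e: (par j) => [w|] //=; rewrite (depth2 e).
rewrite orbF; case: (eqVneq i j) => [->|_] /=; last by rewrite eqxx.
by rewrite (negPf (par_neq j)).
Qed.

(** In depth two, the vertices below w are w itself and its children. *)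
Lemma SW_depth2 k : 0 < k -> SW k depth2_graph =
  \sum_w cutval #|W|.+1 k (\sum_w' (par w' == Some w)).+1.
Proof.
move=> k0; rewrite (SW_cut depth2_connected depth2_cut k0) card_option.
apply: eq_bigr => w _; congr cutval.
have -> : A w = Some w |: [set Some w' | w' in [set w' | par w' == Some w]].
  apply/setP => -[w'|]; rewrite !inE /=.
    by rewrite (mem_imset _ _ Some_inj) inE.
  by apply/esym/negbTE/imsetP => -[].
rewrite cardsU1 (mem_imset _ _ Some_inj) inE par_neq add1n.
rewrite (card_imset _ Some_inj) -sum1_card big_mkcond /=; congr _.+1.
by apply: eq_bigr => w' _; rewrite inE; case: eqP.
Qed.

End DepthTwo.

(** The vertices other than the root are the centres of the branches and, for
    each centre, its leaves. *)
Lemma star_tree k (Q : seq nat) : 0 < k -> exists T : sgraph, is_tree T /\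
  SW k T = let n := (size Q + sumn Q).+1 in
           \sum_(b <- Q) (cutval n k b.+1 + b * cutval n k 1).
Proof.
move=> k0; set I := 'I_(size Q).
pose J := {i : I & 'I_(nth 0 Q i)}; pose W : finType := (I + J)%type.
pose par (w : W) : option W := if w is inr u then Some (inl (tag u)) else None.
have d2 w w' : par w = Some w' -> par w' = None by case: w => //= u [<-].
exists (depth2_graph d2); split.
  exact: is_tree_cut (depth2_connected d2) (depth2_cut d2).
have sumJ (F : I -> nat) : \sum_(u : J) F (tag u) = \sum_(i : I) nth 0 Q i * F i.
  rewrite -(@sig_big_dep _ _ _ _ _ xpredT (fun=> xpredT) (fun i _ => F i)) /=.
  by apply: eq_bigr => i _; rewrite sum_nat_const card_ord.
have cW : #|W| = size Q + sumn Q.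
  rewrite card_sum card_ord -[#|{: J}|]sum1_card (sumJ (fun=> 1)) sumnE.
  by rewrite (big_nth 0) big_mkord; under eq_bigr do rewrite muln1.
rewrite SW_depth2 // cW big_sumType /= (big_nth 0) big_mkord big_split /=.
congr (_ + _).
  apply: eq_bigr => i _; rewrite big_sumType /= big1 // add0n.
  rewrite (sumJ (fun j => (Some (inl j : W) == Some (inl i)) : nat)).
  rewrite (bigD1 i) //= eqxx muln1 big1 ?addn0 // => j ji.
  by rewrite (_ : (_ == _) = false) ?muln0 //; apply/eqP => -[] /eqP; apply/negP.
rewrite -(sumJ (fun=> _)); apply: eq_bigr => u _.
by rewrite big_sumType /= !big1 // => v _; case: eqP.
Qed.

(** * Values of depth-two trees *)

Section Gadgets.
Import Order.TTheory GRing.Theory Num.Theory.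
Local Open Scope ring_scope.
Variables N k : nat.

(** How much f_n(b+1) exceeds f_n(1): the gain of gathering b + 1 vertices in one
    branch instead of attaching them all to the root. *)
Definition gain (b : nat) : int :=
  'C(N, k)%:Z - 'C(b.+1, k)%:Z - 'C(N - b, k)%:Z.

Definition gains (Q : seq nat) : int := \sum_(b <- Q) gain b.

Definition weight (Q : seq nat) : nat := (size Q + sumn Q)%N.

Lemma gains_cat P Q : gains (P ++ Q) = gains P + gains Q.
Proof. by rewrite /gains big_cat. Qed.

Lemma weight_cat P Q : weight (P ++ Q) = (weight P + weight Q)%N.
Proof. rewrite /weight size_cat sumn_cat; lia. Qed.

Lemma weight_cons b Q : weight (b :: Q) = (b.+1 + weight Q)%N.
Proof. rewrite /weight /=; lia. Qed.

Lemma gains_nseq x b : gains (nseq x b) = gain b * x%:Z.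
Proof.
rewrite /gains; elim: x => [|x IHx]; first by rewrite big_nil mulr0.
by rewrite big_cons IHx; lia.
Qed.

Lemma weight_nseq x b : weight (nseq x b) = (x * b.+1)%N.
Proof. rewrite /weight size_nseq sumn_nseq; lia. Qed.

Lemma gain0 : (1 < k)%N -> gain 0 = 0.
Proof. by move=> k1; rewrite /gain subn0 (@bin_small 1) //; lia. Qed.

Lemma cutval_gain b : (1 < k)%N -> (b <= N)%N ->
  (cutval N.+1 k b.+1)%:Z = gain b + 'C(N, k.-1)%:Z.
Proof.
move=> k1 bN; have k0 := ltnW k1; have bN' : (b.+1 <= N.+1)%N by [].
have := cutval_add k0 bN'; rewrite subSS /gain.
by case: k k0 k1 => // k' _ _; rewrite [in RHS]binS /=; lia.
Qed.

Lemma sum_cutval_gains Q : (1 < k)%N -> (weight Q <= N)%N ->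
  (\sum_(b <- Q) (cutval N.+1 k b.+1 + b * cutval N.+1 k 1))%N%:Z =
    'C(N, k.-1)%:Z * (weight Q)%:Z + gains Q.
Proof.
move=> k1.
have c1 : (cutval N.+1 k 1)%:Z = 'C(N, k.-1)%:Z.
  by rewrite cutval_gain // gain0 // add0r.
elim: Q => [|b Q IHQ]; first by rewrite /gains !big_nil mulr0.
rewrite weight_cons => wQ; rewrite /gains !big_cons -/(gains Q).
rewrite !PoszD PoszM c1 IHQ ?cutval_gain //; last 2 first.
- exact: leq_trans (leq_trans (leqnSn b) (leq_addr _ _)) wQ.
- exact: leq_trans (leq_addl _ _) wQ.
by rewrite -addn1 !PoszD; ring.
Qed.

Lemma depth2_value Q : (1 < k)%N -> (weight Q <= N)%N ->
  exists T : sgraph, is_tree T /\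
    (SW k T)%:Z = 'C(N, k.-1)%:Z * N%:Z + gains Q.
Proof.
(* Branches with b = 0 have weight 1 and gain 0: they fill the weight up to N. *)
move=> k1 wQ; set R := Q ++ nseq (N - weight Q) 0.
have wR : weight R = N by rewrite weight_cat weight_nseq; lia.
have [T [tT SWT]] := star_tree R (ltnW k1).
exists T; split=> //; rewrite {}SWT /= -[(size R + sumn R)%N]/(weight R) wR.
rewrite sum_cutval_gains // wR //.
by rewrite gains_cat gains_nseq gain0 // mul0r addr0.
Qed.

Lemma bin_convex x y : (1 < k)%N ->
  ('C(x.+1, k) + 'C(y.+1, k) <= 'C((x + y).+1, k))%N.
Proof.
case: k => [|[|k']] // _; elim: x => [|x IHx]; first by rewrite bin_small.
rewrite binS addSn [X in (_ <= X)%N]binS.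
have : ('C(x.+1, k'.+1) <= 'C((x + y).+1, k'.+1))%N by apply: leq_bin2l; lia.
lia.
Qed.

Lemma gain_ge0 b : (1 < k)%N -> (b < N)%N -> 0 <= gain b.
Proof.
move=> k1 bN; have := bin_convex b (N - b.+1) k1.
rewrite (_ : (N - b.+1).+1 = N - b)%N; last by lia.
rewrite (_ : (b + (N - b.+1)).+1 = N)%N; last by lia.
rewrite /gain; lia.
Qed.

Lemma gain_le b : (0 < k)%N -> gain b <= 'C(N, k.-1)%:Z * b%:Z.
Proof.
rewrite /gain; case: k => // k' _ /=.
suff : ('C(N, k'.+1) <= 'C(N - b, k'.+1) + 'C(N, k') * b)%N by lia.
elim: b => [|b IHb]; first by rewrite subn0; lia.
apply: leq_trans IHb _; rewrite mulnS addnA leq_add2r.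
have [Nb|bN] := leqP N b.
  by rewrite (_ : N - b = 0)%N //; apply/eqP; rewrite subn_eq0.
rewrite -(subnSK bN) binS leq_add2l; apply: leq_bin2l; lia.
Qed.

Lemma gains_bounds Q : (1 < k)%N -> (weight Q <= N)%N ->
  0 <= gains Q <= 'C(N, k.-1)%:Z * (weight Q)%:Z.
Proof.
move=> k1; rewrite /gains; elim: Q => [|b Q IHQ] wQ.
  by rewrite big_nil mulr_ge0.
rewrite big_cons weight_cons in wQ *; have /andP[IH1 IH2] := IHQ (leq_trans (leq_addl _ _) wQ).
have := gain_le b (ltnW k1); have := @gain_ge0 b k1; rewrite PoszD mulrDr.
move=> /(_ (leq_trans (leq_addr _ _) wQ)) g0 g1.
by rewrite addr_ge0 //= lerD // (le_trans g1) // ler_wpM2l // lez_nat.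
Qed.

(** A gadget of value v is an exchange between two families of branches: it
    trades weight at most c for a change of v in the index. *)
Definition gadget (v : int) (c : nat) : Prop :=
  exists P Q, [/\ gains P = v + gains Q, (weight P <= c)%N & (weight Q <= c)%N].

Lemma gadgetW v c c' : (c <= c')%N -> gadget v c -> gadget v c'.
Proof.
by move=> cc' [P [Q [PQ wP wQ]]]; exists P, Q; split=> //; apply: leq_trans cc'.
Qed.

Lemma gadget_opp v c : gadget v c -> gadget (- v) c.
Proof. by move=> [P [Q [PQ wP wQ]]]; exists Q, P; split=> //; rewrite PQ; ring. Qed.

Lemma gadget_sub v v' c c' : gadget v c -> gadget v' c' -> gadget (v - v') (c + c').
Proof.
move=> [P [Q [PQ wP wQ]]] [P' [Q' [PQ' wP' wQ']]].
exists (P ++ Q'), (Q ++ P'); split; rewrite ?weight_cat ?leq_add //.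
by rewrite !gains_cat PQ PQ'; ring.
Qed.

Lemma gadget_gain b : gadget (gain b) b.+1.
Proof.
by exists [:: b], [::]; rewrite /gains big_seq1 big_nil addr0 /weight /= addn0.
Qed.

Definition diff (d : nat) (u : nat -> int) (b : nat) : int := u (b + d)%N - u b.

Lemma gadget_diff u c s d : (forall b, gadget (u b) (c * (b + s))) ->
  forall b, gadget (diff d u b) (2 * c * (b + (s + d))).
Proof.
move=> Hu b; apply: gadgetW (gadget_sub (Hu (b + d)%N) (Hu b)); nia.
Qed.

Lemma diff_sum d u b : diff d u b = \sum_(i < d) diff 1 u (b + i).
Proof.
elim: d => [|d IHd]; first by rewrite /diff addn0 subrr big_ord0.
by rewrite big_ord_recr /= -IHd /diff -addnA addn1; ring.
Qed.

(** With steps of size d a second difference gathers d^2 unit ones, while its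
    weight only grows like d. *)
Lemma diff_diff_sum d u b :
  diff d (diff d u) b = \sum_(i < d) \sum_(j < d) diff 1 (diff 1 u) (b + i + j).
Proof.
rewrite diff_sum; apply: eq_bigr => i _; rewrite -diff_sum /diff.
by rewrite -!addnA [(d + 1)%N]addnC; ring.
Qed.

(** The j-th difference of the gain at b, up to the sign (-1)^(j+1). *)
Definition step (j b : nat) : int :=
  'C(N - b - j, k - j)%:Z + (-1) ^+ j * 'C(b.+1, k - j)%:Z.

Lemma diff_gain b : (0 < k)%N -> (b < N)%N -> diff 1 gain b = step 1 b.
Proof.
rewrite /diff /gain /step; case: k => // k' _ bN.
rewrite !subn1 addn1 -(subnSK bN) !succnK binS ['C((N - b.+1).+1, _)]binS.
by rewrite !PoszD expr1; ring.
Qed.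

Lemma diff_step j b : (j < k)%N -> (b + j < N)%N ->
  diff 1 (step j) b = - step j.+1 b.
Proof.
rewrite /diff /step addn1 => jk bj.
rewrite (_ : k - j = (k - j.+1).+1)%N; last by lia.
rewrite (_ : N - b - j = (N - b - j.+1).+1)%N; last by lia.
rewrite (_ : N - b.+1 - j = N - b - j.+1)%N; last by lia.
rewrite [in 'C(b.+2, _)]binS ['C((N - b - j.+1).+1, _)]binS !PoszD exprS; ring.
Qed.

Lemma iter_diff j b : (j < k)%N -> (b + j < N)%N ->
  iter j.+1 (diff 1) gain b = (-1) ^+ j * step j.+1 b.
Proof.
elim: j b => [|j IHj] b jk bj.
  by rewrite addn0 in bj; rewrite expr0 mul1r [LHS]diff_gain.
rewrite iterS /diff !IHj; try lia.
rewrite -mulrBr -/(diff 1 (step j.+1) b) diff_step //.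
by rewrite exprS; ring.
Qed.

Lemma gadget_sign j v c : gadget ((-1) ^+ j * v) c -> gadget v c.
Proof.
rewrite -signr_odd; case: odd; rewrite ?expr0 ?expr1 ?mul1r // mulN1r.
by move/gadget_opp; rewrite opprK.
Qed.

Lemma gadget_iter j b : gadget (iter j (diff 1) gain b) (2 ^ j * (b + (1 + j))).
Proof.
elim: j b => [|j IHj] b; first by rewrite mul1n addn0 addn1; apply: gadget_gain.
by apply: gadgetW (gadget_diff 1 IHj b); rewrite expnS -addnA addn1.
Qed.

Lemma gadget_step j : (0 < j <= k)%N -> (j <= N)%N ->
  gadget (step j 0) (2 ^ j * (1 + j)).
Proof.
case: j => // j /= jk jN; apply: (@gadget_sign j).
by rewrite -iter_diff //; apply: gadget_iter.
Qed.

Lemma gadget_step_square j d : (1 < j <= k)%N -> (d + d + j <= N)%N ->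
  gadget (\sum_(a < d) \sum_(b < d) step j (a + b)) (2 ^ j * (j + d + d)).
Proof.
case: j => [|[|j]] // jk jN; apply: (@gadget_sign j.+1).
have -> : (-1) ^+ j.+1 * \sum_(a < d) \sum_(b < d) step j.+2 (a + b) =
          diff d (diff d (iter j (diff 1) gain)) 0.
  rewrite diff_diff_sum mulr_sumr; apply: eq_bigr => a _.
  rewrite mulr_sumr; apply: eq_bigr => b _; rewrite -iter_diff //.
  by have := ltn_ord a; have := ltn_ord b; lia.
have := gadget_diff d (gadget_diff d (gadget_iter j)) 0.
by apply: gadgetW; rewrite !expnS; nia.
Qed.

End Gadgets.

(** * Intervals of values *)

Lemma bin_scale x y m : x + m <= y.*2 -> 'C(x, m) <= 2 ^ m * 'C(y, m).
Proof.
elim: m x y => [|m IHm] [|x] [|y] // xy; rewrite ?bin0n //.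
rewrite -(@leq_pmul2l m.+1) // -mul_bin_diag mulnCA -mul_bin_diag expnS /=.
have := IHm x y; have -> : x + m <= y.*2 by lia.
move/(_ isT) => H; apply: leq_trans (leq_mul (_ : x.+1 <= y.+1.*2) H) _; lia.
Qed.

Section Covering.
Import Order.TTheory GRing.Theory Num.Theory.
Local Open Scope ring_scope.
Variables N k : nat.
Local Notation gains := (gains N k).
Local Notation gadget := (gadget N k).
Local Notation step := (step N k).

(** An arithmetic progression of l consecutive gains with common difference s,
    all realised within weight c. The first term is left free: it comes from the
    branches that the gadgets need to have available for exchange. *)
Definition cover (s c l : nat) : Prop :=
  exists base : int, forall t, (t < l)%N ->
    exists2 Q, gains Q = base + (s * t)%N%:Z & (weight Q <= c)%N.

Lemma coverW s c c' l l' :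
  (c <= c')%N -> (l' <= l)%N -> cover s c l -> cover s c' l'.
Proof.
move=> cc' ll' [base H]; exists base => t tl.
by have [Q gQ wQ] := H t (leq_trans tl ll'); exists Q => //; apply: leq_trans cc'.
Qed.

Lemma cover_one s : cover s 0 1.
Proof.
exists 0 => -[|t] // _; exists [::]; rewrite /weight // /gains big_nil muln0 addr0 //.
Qed.

(** Leaving a gadget in its first or second state translates the progression by
    v or not, and the two translates overlap when v <= l. *)
Lemma cover_gadget s c l v c' : (v <= l)%N -> gadget (s * v)%N%:Z c' ->
  cover s c l -> cover s (c + c') (l + v).
Proof.
move=> vl [P [Q [PQ wP wQ]]] [base H]; exists (base + gains Q) => t tlv.
have [tl|lt] := ltnP t l.
  have [R gR wR] := H t tl; exists (R ++ Q); last by rewrite weight_cat leq_add.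
  by rewrite gains_cat gR; ring.
have [|R gR wR] := H (t - v)%N; first by lia.
exists (R ++ P); last by rewrite weight_cat leq_add.
rewrite gains_cat gR PQ; have -> : t = (t - v + v)%N by rewrite subnK //; lia.
by rewrite addnK mulnDr PoszD; ring.
Qed.

Lemma cover_gadgets x s c l v c' : (v <= l)%N -> gadget (s * v)%N%:Z c' ->
  cover s c l -> cover s (c + x * c') (l + x * v).
Proof.
move=> vl gv Hc; elim: x => [|x IHx]; first by rewrite !mul0n !addn0.
have := cover_gadget _ gv IHx; rewrite !mulSn => /(_ (leq_trans vl (leq_addr _ _))).
by apply: coverW; lia.
Qed.

(** Progressions of difference 2 starting at 0 and at the odd number v cover, from
    v - 1 on, both parities. *)
Lemma cover_odd c l v c' : odd v -> (v <= l)%N -> gadget v%:Z c' ->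
  cover 2 c l -> cover 1 (c + c') v.
Proof.
move=> ov vl [P [Q [PQ wP wQ]]] [base H].
exists (base + gains Q + v.-1%:Z) => t tv.
have [ot|et] := boolP (odd t).
  have [|R gR wR] := H ((t + v.-1 - v)./2); first by lia.
  exists (R ++ P); last by rewrite weight_cat leq_add.
  rewrite gains_cat gR PQ; have E : (t + v.-1 = 2 * (t + v.-1 - v)./2 + v)%N by lia.
  by have := congr1 Posz E; rewrite mul1n !PoszD; lia.
have [|R gR wR] := H ((t + v.-1)./2); first by lia.
exists (R ++ Q); last by rewrite weight_cat leq_add.
rewrite gains_cat gR; have E : (t + v.-1 = 2 * (t + v.-1)./2)%N by lia.
by have := congr1 Posz E; rewrite mul1n !PoszD; lia.
Qed.

Variable d : nat.
Hypothesis big_N : (10 * d + 4 * k + 2 <= N)%N.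

(** The term C(N-b-j, k-j) dominates, b being small compared with N. *)
Lemma step_bounds j b : (0 < j < k)%N -> (b <= d + d)%N ->
  exists v : nat, [/\ step j b = v, ('C(N, k - j) <= 2 ^ k.+1 * v)%N &
    (v <= 2 * 'C(N, k - j))%N].
Proof.
move=> jk bd; set m := (k - j)%N; have m0 : (0 < m)%N by rewrite /m; lia.
set x := 'C(N - b - j, m); set y := 'C(b.+1, m).
have xC : (x <= 'C(N, m))%N by apply: leq_bin2l; lia.
have yx : (y + y <= x)%N.
  by apply: leq_trans (bin_addl _ _ m0) _; apply: leq_bin2l; lia.
have Cx : ('C(N, m) <= 2 ^ k * x)%N.
  apply: leq_trans (@bin_scale N (N - b - j) m _) _; first by rewrite /m; lia.
  by rewrite leq_mul2r leq_pexp2l ?orbT // leq_subr.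
rewrite /step -/m -/x -/y -signr_odd; case: odd.
  exists (x - y)%N; split; [rewrite expr1; lia | rewrite expnS; nia | lia].
exists (x + y)%N; split; [rewrite expr0; lia | rewrite expnS; nia | lia].
Qed.

Lemma step_square_bounds j : (0 < j < k)%N ->
  exists v : nat, [/\ \sum_(a < d) \sum_(b < d) step j (a + b) = v%:Z,
    (d * d * 'C(N, k - j) <= 2 ^ k.+1 * v)%N &
    (v <= d * d * (2 * 'C(N, k - j)))%N].
Proof.
move=> jk; pose F (a b : 'I_d) := `|step j (a + b)|%N.
have HF (a b : 'I_d) : [/\ step j (a + b) = F a b, ('C(N, k - j) <= 2 ^ k.+1 * F a b)%N &
    (F a b <= 2 * 'C(N, k - j))%N].
  have [|v []] := @step_bounds j (a + b) jk.
    by have := ltn_ord a; have := ltn_ord b; lia.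
  by rewrite /F => ->.
have sumC (X : nat) : (d * X = \sum_(a < d) X)%N by rewrite sum_nat_const card_ord.
exists (\sum_(a < d) \sum_(b < d) F a b)%N; split.
- rewrite (big_morph Posz PoszD (erefl _)); apply: eq_bigr => a _.
  rewrite (big_morph Posz PoszD (erefl _)); apply: eq_bigr => b _.
  by have [] := HF a b.
- rewrite big_distrr /= -mulnA sumC; apply: leq_sum => a _.
  by rewrite big_distrr /= sumC; apply: leq_sum => b _; have [] := HF a b.
rewrite -mulnA sumC; apply: leq_sum => a _.
by rewrite sumC; apply: leq_sum => b _; have [] := HF a b.
Qed.

Variable x : nat.
Hypothesis big_x : (N * 2 ^ k.+2 <= x * (d * d))%N.
Hypothesis d_gt0 : (0 < d)%N.

(** The weight of d^2 2^(k+2) unit differences and x differences with step d: by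
    [step_bounds] the former reach the value of one difference with step d, and
    the latter then reach the size of the next lower order difference. *)
Definition level_cost : nat :=
  d * d * 2 ^ k.+2 * (2 ^ k * k.+1) + x * (2 ^ k * (k + d + d)).

Lemma level_gadget j : (0 < j <= k)%N -> gadget (step j 0) (2 ^ k * k.+1).
Proof.
move=> jk; apply: gadgetW (gadget_step jk _); last by lia.
by apply: leq_mul; [apply: leq_pexp2l|]; lia.
Qed.

Lemma level_gadget_square j : (1 < j <= k)%N ->
  gadget (\sum_(a < d) \sum_(b < d) step j (a + b)) (2 ^ k * (k + d + d)).
Proof.
move=> jk; apply: gadgetW (gadget_step_square jk _); last by lia.
by apply: leq_mul; [apply: leq_pexp2l|]; lia.
Qed.

(** This is where k must be even: the k-th difference is then 2, and not 0, and
    the one of order k - 1 is N - k, which is odd. *)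
Lemma cover_top : (1 < k)%N -> ~~ odd k -> odd N ->
  cover 1 (level_cost + 2 ^ k * k.+1) `|step k.-1 0|.
Proof.
move=> k1 ek oN.
have stepk b : step k b = 2.
  by rewrite /step subnn !bin0 -signr_odd (negPf ek) expr0.
have stepk1 : step k.-1 0 = (N - k)%N.
  rewrite /step subn0 (_ : k - k.-1 = 1)%N; last by lia.
  rewrite !bin1 -signr_odd (_ : odd k.-1) ?expr1; lia.
have g2 : gadget (2 * 1)%N%:Z (2 ^ k * k.+1).
  by have := @level_gadget k; rewrite stepk; apply; lia.
have gd : gadget (2 * (d * d))%N%:Z (2 ^ k * (k + d + d)).
  have := @level_gadget_square k; rewrite k1 leqnn => /(_ isT).
  congr gadget; under eq_bigr do under eq_bigr do rewrite stepk.
  by rewrite !sumr_const !card_ord; lia.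
have go : gadget (N - k)%N%:Z (2 ^ k * k.+1).
  by rewrite -stepk1; apply: level_gadget; lia.
rewrite stepk1 absz_nat; apply: (cover_odd _ _ go) (_ : cover 2 _ N); try lia.
have := cover_gadgets (d * d * 2 ^ k.+2) (leqnn 1) g2 (cover_one 2).
have p2 : (0 < 2 ^ k.+2)%N by rewrite expn_gt0.
(* Progressions of difference 2: d^2 2^(k+2) gadgets of value 2, more than enough
   to reach 2 d^2, then x gadgets of value 2 d^2. *)
have dv : (d * d <= 1 + d * d * 2 ^ k.+2 * 1)%N by nia.
move/(cover_gadgets x dv gd); apply: coverW; first by rewrite /level_cost; lia.
nia.
Qed.

Lemma cover_level j c : (1 < j < k)%N ->
  cover 1 c `|step j 0| -> cover 1 (c + level_cost) `|step j.-1 0|.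
Proof.
move=> jk; have [||v [ev v1 v2]] := @step_bounds j 0; try lia.
have [|w [ew w1 w2]] := @step_square_bounds j; first by lia.
have [||u [eu u1 u2]] := @step_bounds j.-1 0; try lia.
have gv : gadget (1 * v)%N%:Z (2 ^ k * k.+1).
  by rewrite mul1n -ev; apply: level_gadget; lia.
have gw : gadget (1 * w)%N%:Z (2 ^ k * (k + d + d)).
  by rewrite mul1n -ew; apply: level_gadget_square; lia.
rewrite ev eu !absz_nat => Hc.
have := cover_gadgets (d * d * 2 ^ k.+2) (leqnn v) gv Hc.
have wv : (w <= v + d * d * 2 ^ k.+2 * v)%N.
  rewrite !expnS in v1 *; nia.
move/(cover_gadgets x wv gw); apply: coverW; first by rewrite /level_cost; lia.
have uw : (u <= x * w)%N; last by lia.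
rewrite -(@leq_pmul2l (2 ^ k.+1)) ?expn_gt0 //.
have Cm : ('C(N, k - j.-1) <= N * 'C(N, k - j))%N.
  rewrite (_ : k - j.-1 = (k - j).+1)%N; last by lia.
  have := mul_bin_left N (k - j); nia.
apply: (@leq_trans (x * (d * d * 'C(N, k - j)))); last by nia.
rewrite mulnA; apply: leq_trans (leq_mul big_x (leqnn _)).
rewrite !expnS; nia.
Qed.

Lemma cover_bottom : (1 < k)%N -> ~~ odd k -> odd N ->
  cover 1 (k * level_cost) `|step 1 0|.
Proof.
move=> k1 ek oN.
have H i : (i + 2 <= k)%N ->
  cover 1 (i.+1 * level_cost + 2 ^ k * k.+1) `|step (k.-1 - i) 0|.
  elim: i => [|i IHi] ik; first by rewrite mul1n subn0; apply: cover_top.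
  have := @cover_level (k.-1 - i) _ _ (IHi _); rewrite subnS mulSn [X in cover _ X _]addnC.
  by rewrite addnA; apply; lia.
have := H (k - 2)%N; rewrite (_ : k.-1 - (k - 2) = 1)%N; last by lia.
rewrite subnK // => /(_ (leqnn k)); apply: coverW => //.
have -> : (k * level_cost = (k - 2).+1 * level_cost + level_cost)%N.
  by rewrite -mulSnr; congr (_ * _)%N; lia.
rewrite leq_add2l /level_cost; apply: leq_trans (leq_addr _ _).
by apply: leq_pmull; rewrite muln_gt0 expn_gt0 muln_gt0 d_gt0.
Qed.

End Covering.

(** The total weight is about k 2^k (k + 2 d) x with x close to N 2^(k+2) / d^2,
    hence a constant times N / d plus a constant; d is chosen to make the first
    part at most N / 32. *)
Lemma cheap_cover k : 1 < k -> ~~ odd k -> exists N0, forall N, N0 <= N -> odd N ->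
  exists2 c, 16 * c <= N & cover N k 1 c `|step N k 1 0|%N.
Proof.
move=> k1 ek; pose a := 48 * k * 2 ^ k; pose d := 2 * a * 2 ^ k.+2.
pose c1 := d * d * 2 ^ k.+2 * (2 ^ k * k.+1); pose c2 := 2 ^ k * (k + d + d).
exists (32 * k * (c1 + c2) + (10 * d + 4 * k + 2)) => N NN0 oN.
have p0 : 0 < 2 ^ k by rewrite expn_gt0.
have p2 : 0 < 2 ^ k.+2 by rewrite expn_gt0.
have dk : k <= d.
  apply: leq_trans (leq_pmulr _ p2); rewrite /a; apply: (@leq_trans (k * 2 ^ k)).
    exact: leq_pmulr.
  by rewrite !mulnA leq_mul2r; apply/orP; right; lia.
have d0 : 0 < d by apply: leq_trans dk; lia.
have dd0 : 0 < d * d by rewrite muln_gt0 d0.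
pose q := N * 2 ^ k.+2 %/ (d * d).
have big_x : N * 2 ^ k.+2 <= q.+1 * (d * d) by rewrite ltnW // ltn_ceil.
have big_N : 10 * d + 4 * k + 2 <= N by apply: leq_trans NN0; rewrite leq_addl.
exists (k * level_cost k d q.+1); last exact: cover_bottom.
have qd : 2 * a * d * q <= N.
  rewrite -(@leq_pmul2r (2 ^ k.+2)) //.
  have <- : q * (d * d) = 2 * a * d * q * 2 ^ k.+2 by rewrite {2}/d; ring.
  exact: leq_trunc_div.
have c2q : 32 * k * c2 * q <= N.
  apply: leq_trans qd; rewrite leq_mul2r; apply/orP; right.
  rewrite /c2 /a; have -> : 2 * (48 * k * 2 ^ k) * d = 32 * k * (2 ^ k * (3 * d)) by ring.
  by rewrite !leq_mul2l; do 2 (apply/orP; right); lia.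
have N0N : 32 * k * (c1 + c2) <= N by apply: leq_trans NN0; rewrite leq_addr.
have -> : level_cost k d q.+1 = c1 + q.+1 * c2 by [].
clearbody c1 c2 q; nia.
Qed.

Section Intervals.
Import Order.TTheory GRing.Theory Num.Theory.
Variable k : nat.
Hypotheses (k1 : 1 < k) (ek : ~~ odd k).

(** The end of the interval of values obtained on N + 1 vertices. Its start is
    taken to be 17/16 N C(N,k-1), the sixteenth being an upper bound for the
    first term of the progression in [cover]. *)
Definition interval_end N := N * 'C(N, k.-1) + N %/ 4 * `|step N k 1 0|%N.

Lemma step1_bound N : 8 * k + 2 <= N -> 'C(N, k.-1) <= 2 * `|step N k 1 0|%N.
Proof.
move=> Nk; rewrite /step !subn1 expr1.
have C4 : 4 <= 'C(N, k.-1) by apply: leq_trans (leq_bin _ _); lia.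
have y1 : 'C(1, k.-1) <= 1 by case: (k.-1) => [|[|i]].
have E : N * 'C(N.-1, k.-1) = (N - k.-1) * 'C(N, k.-1) by rewrite mul_bin_down.
rewrite subn0; have x3 : 3 * 'C(N, k.-1) <= 4 * 'C(N.-1, k.-1).
  rewrite -(@leq_pmul2l N); last by lia.
  rewrite mulnCA [X in _ <= X]mulnCA E !mulnA leq_mul2r; apply/orP; right; lia.
lia.
Qed.

Lemma interval_values N c m : 8 * k + 2 <= N -> 16 * c <= N ->
  cover N k 1 c `|step N k 1 0|%N ->
  17 * (N * 'C(N, k.-1)) <= 16 * m -> m < interval_end N -> SW_tree_values k m.
Proof.
move=> Nk cN [base H] mlo; rewrite /interval_end.
have stepE : step N k 1 0 = gain N k 1.
  rewrite -diff_gain; [|lia..].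
  by rewrite /diff gain0 ?subr0.
have s0 : 0 < `|step N k 1 0|%N.
  have := step1_bound Nk; have : 0 < 'C(N, k.-1) by rewrite bin_gt0; lia.
  lia.
have gE : gain N k 1 = Posz `|step N k 1 0|%N.
  rewrite stepE gez0_abs //; apply: gain_ge0; lia.
have wN Q : weight Q <= c -> weight Q <= N by move=> wQ; lia.
have [Q0 gQ0 wQ0] := H 0 s0; have := gains_bounds k1 (wN _ wQ0).
rewrite gQ0 muln0 addr0 => /andP[b0 b1].
move: s0 gE H {gQ0}; set w := `|_|%N => s0 gE H mhi.
set C := 'C(N, k.-1) in mlo b1 mhi.
have bE : base = Posz `|base|%N by rewrite gez0_abs.
move: (`|base|%N) bE => b bE; rewrite {}bE in b0 b1 H.
have bC : 16 * b <= N * C by clear -b1 wQ0 cN; nia.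
(* The offset t is split as (t / w) w + t %% w: branches with b = 1, each of gain
   w, account for the quotient, and the cover for the remainder. *)
pose t := m - N * C - b.
have tw : t < N %/ 4 * w by rewrite /t; lia.
have tE : m = N * C + b + t by rewrite /t; lia.
have [|R gR wR] := H (t %% w); first by rewrite ltn_mod.
pose Q := R ++ nseq (t %/ w) 1.
have xN : t %/ w < N %/ 4 by rewrite ltn_divLR.
have wQ : weight Q <= N by rewrite weight_cat weight_nseq; lia.
have [T [tT ST]] := depth2_value k1 wQ.
exists T; split=> //; apply/eqP; rewrite -eqz_nat ST gains_cat gR gains_nseq gE.
rewrite tE -/C [in X in _ == X](divn_eq t w) mul1n; apply/eqP.
by rewrite !PoszD !PoszM; ring.
Qed.

Lemma bin_succ_ratio n m : 101 * m <= n.+1 -> 100 * 'C(n.+1, m) <= 101 * 'C(n, m).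
Proof.
move=> mn; have := mul_bin_down n.+1 m => /= E.
case: m mn E => [|m] mn E; first by rewrite !bin0.
rewrite -(@leq_pmul2l (n.+1 - m.+1)); last by lia.
rewrite mulnCA -E mulnCA [X in _ <= X]mulnCA !mulnA leq_mul2r; apply/orP; right; lia.
Qed.

(** As step 1 0 is at least C(N,k-1) / 2, the interval for N ends beyond about
    18/16 N C(N,k-1); the next one starts at 17/16 (N+2) C(N+2,k-1), where
    C(N+2,k-1) exceeds C(N,k-1) by a factor of at most (101/100)^2. *)
Lemma intervals_overlap N : 101 * k + 100 <= N ->
  17 * (N.+2 * 'C(N.+2, k.-1)) <= 16 * interval_end N.
Proof.
move=> kN; rewrite /interval_end; have w1 : 'C(N, k.-1) <= 2 * `|step N k 1 0|%N.
  by apply: step1_bound; lia.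
have r1 : 100 * 'C(N.+1, k.-1) <= 101 * 'C(N, k.-1) by apply: bin_succ_ratio; lia.
have r2 : 100 * 'C(N.+2, k.-1) <= 101 * 'C(N.+1, k.-1) by apply: bin_succ_ratio; lia.
have dN : N <= 4 * (N %/ 4) + 3 by lia.
move: (`|_|%N) ('C(N, _)) ('C(N.+1, _)) ('C(N.+2, _)) (N %/ 4) w1 r1 r2 dN.
move=> w C C1 C2 e w1 r1 r2 dN.
have r : 100 * 100 * C2 <= 101 * 101 * C by lia.
have ew : (N - 3) * C <= 8 * (e * w) by nia.
have : 17 * 101 * 101 * N.+2 * C <= 100 * 100 * (16 * N + 2 * (N - 3)) * C.
  by rewrite leq_mul2r; apply/orP; right; lia.
nia.
Qed.

Lemma even_cofinite : cofinite (SW_tree_values k).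
Proof.
have [N0 HN0] := cheap_cover k1 ek.
pose N1 := (N0 + 101 * k + 100).*2.+1.
have N1i i : [/\ N0 <= N1 + i.*2, 101 * k + 100 <= N1 + i.*2 & odd (N1 + i.*2)].
  by rewrite /N1; split; lia.
have hit i m : 17 * ((N1 + i.*2) * 'C(N1 + i.*2, k.-1)) <= 16 * m ->
    m < interval_end (N1 + i.*2) -> SW_tree_values k m.
  have [big0 bigk oN] := N1i i; have [c cN Hc] := HN0 _ big0 oN.
  by apply: interval_values Hc; lia.
have cov i m : 17 * (N1 * 'C(N1, k.-1)) <= m -> m < interval_end (N1 + i.*2) ->
    SW_tree_values k m.
  elim: i m => [|i IHi] m mlo mhi; first by apply: hit mhi; rewrite addn0; lia.
  have [|lt] := leqP (17 * ((N1 + i.+1.*2) * 'C(N1 + i.+1.*2, k.-1))) (16 * m).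
    by move/hit; apply.
  apply: IHi => //; have [_ bigk _] := N1i i; have := intervals_overlap bigk.
  by move: lt; rewrite doubleS !addnS; lia.
exists (17 * (N1 * 'C(N1, k.-1))) => m mlo; apply: (cov m m mlo).
have C0 : 0 < 'C(N1 + m.*2, k.-1).
  by have [_ bigk _] := N1i m; rewrite bin_gt0; lia.
rewrite /interval_end; apply: leq_trans (leq_addr _ _).
apply: leq_trans (leq_pmulr _ C0); rewrite /N1; lia.
Qed.

End Intervals.

Theorem theorem1p1 (k : nat) (hk : 2 <= k) :
  cofinite (SW_tree_values k) <-> ~~ odd k.
Proof.
split; last exact: even_cofinite.
by move=> co; apply/negP => ok; apply: (odd_not_cofinite hk ok).
Qed.
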